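(* Let $\phi: L^1_+\to L^1_+$ be an allocation rule. Then $\phi$ satisfies feasibility, scale invariance, independence of a future income, consistency and point-wise continuity if and only if one of the following holds: (i) $\phi$ is the full-transfer rule, i.e. $\phi_i(r)=0$ for all $r\in L^1_+$ and $i\in\mathbb{Z}$; or (ii) there is a function $\lambda:\mathbb{Z}\to[0,1]$ such that $\phi=\phi^\lambda$ is the geometric rule associated with $\lambda$ and for each $i\in\mathbb{Z}$ there exists $j<i$ with $\lambda_j=1$.
   Context: $L^1$ is the set of functions $r:\mathbb{Z}\to\mathbb{R}$, $i\mapsto r_i$, with $\sum_{i\in\mathbb{Z}}|r_i|<+\infty$, and $L^1_+$ is the subset of those with $r_i\ge 0$ for all $i$. An allocation rule is any function $\phi:L^1_+\to L^1_+$; $\phi_i(r)$ denotes the $i$-th coordinate of $\phi(r)$. Empty products equal $1$. Geometric rule associated with $\lambda:\mathbb{Z}\to[0,1]$: the allocation rule $\phi^\lambda$ given, for each $r\in L^1_+$ and $i\in\mathbb{Z}$, by $\phi^\lambda_i(r)=\lambda_i\sum_{j\le i}\prod_{k=j}^{i-1}(1-\lambda_k)r_j$. Axioms for an allocation rule $\phi$: Feasibility: for each $r\in L^1_+$, $\sum_{i\in\mathbb{Z}}\phi_i(r)\le\sum_{i\in\mathbb{Z}}r_i$. Scale invariance: for each $r\in L^1_+$ and each real $\alpha\ge 0$, $\phi(\alpha r)=\alpha\phi(r)$. Independence of a future income: if $j\in\mathbb{Z}$ and $r,r'\in L^1_+$ satisfy $r_i=r'_i$ for each $i\in\mathbb{Z}\setminus\{j\}$,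 then $\phi_i(r)=\phi_i(r')$ for each $i<j$. Consistency: given $\phi$, $r\in L^1_+$ and $j\in\mathbb{Z}$, define the stream $r^j:\mathbb{Z}\to\mathbb{R}$ by $r^j_i=r_i$ if $i>j$; $r^j_j=r_j+\sum_{i<j}(r_i-\phi_i(r))$; $r^j_i=0$ if $i<j$. The axiom requires that for each $r\in L^1_+$ and each $j\in\mathbb{Z}$ such that $r^j\in L^1_+$, one has $\phi_i(r)=\phi_i(r^j)$ for each $i\ge j$. Point-wise continuity: whenever $r\in L^1_+$ and $(r^m)_{m\ge 0}$ is a sequence in $L^1_+$ with $r^m_i\to r_i$ as $m\to\infty$ for every $i\in\mathbb{Z}$, then $\phi_i(r^m)\to\phi_i(r)$ as $m\to\infty$ for every $i\in\mathbb{Z}$. *)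

(* Defs.v *)
From HB Require Import structures.
From mathcomp Require Import all_boot all_order all_algebra.
From mathcomp Require Import all_classical all_reals all_analysis.

Set Implicit Arguments.
Unset Strict Implicit.
Unset Printing Implicit Defensive.

Import Order.TTheory GRing.Theory Num.Theory.
Import numFieldNormedType.Exports.

Local Open Scope classical_set_scope.
Local Open Scope ring_scope.

Section Income.
Variable R : realType.

(* Sum of an absolutely summable real family over a set of integers, as the
   sum of the positive part minus that of the negative part (the form used by
   [esumB]); the value carries no meaning for families that are not summable. *)
Definition zsum (D : set int) (f : int -> R) : R :=
  fine (\esum_(i in D) (EFin \o f)^\+ i - \esum_(i in D) (EFin \o f)^\- i)%E.

Definition L1 : set (int -> R) :=
  [set r | summable [set: int] (EFin \o r)].

Definition L1plus : set (int -> R) :=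
  [set r | L1 r /\ forall i, 0 <= r i].

(* A rule is encoded by a function on all streams, of which only the values on
   [L1plus] matter: every notion below evaluates it on [L1plus] only. *)
Definition rule : Type := (int -> R) -> (int -> R).

Definition allocation_rule (phi : rule) : Prop :=
  forall r, L1plus r -> L1plus (phi r).

Definition geometric_rule (lambda : int -> R) : rule := fun r i =>
  lambda i * zsum [set j | j <= i]
    (fun j => (\big[*%R/1]_(k \in [set k | j <= k < i]) (1 - lambda k)) * r j).

Definition full_transfer (phi : rule) : Prop :=
  forall r, L1plus r -> forall i, phi r i = 0.

Definition is_geometric (lambda : int -> R) (phi : rule) : Prop :=
  forall r, L1plus r -> forall i, phi r i = geometric_rule lambda r i.

Definition feasibility (phi : rule) : Prop :=
  forall r, L1plus r -> zsum [set: int] (phi r) <= zsum [set: int] r.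

Definition scale_invariance (phi : rule) : Prop :=
  forall r (alpha : R), L1plus r -> 0 <= alpha ->
    forall i, phi (fun k => alpha * r k) i = alpha * phi r i.

Definition independence_future (phi : rule) : Prop :=
  forall (j : int) r r', L1plus r -> L1plus r' ->
    (forall i, i != j -> r i = r' i) ->
    forall i, i < j -> phi r i = phi r' i.

Definition reduced_stream (phi : rule) (r : int -> R) (j : int) : int -> R :=
  fun i => if j < i then r i
           else if i == j then r j + zsum [set k | k < j] (fun k => r k - phi r k)
           else 0.

Definition consistency (phi : rule) : Prop :=
  forall r (j : int), L1plus r -> L1plus (reduced_stream phi r j) ->
    forall i, j <= i -> phi r i = phi (reduced_stream phi r j) i.

Definition pointwise_continuity (phi : rule) : Prop :=
  forall r (u : nat -> int -> R), L1plus r -> (forall m, L1plus (u m)) ->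
    (forall i, u m i @[m --> \oo] --> r i) ->
    forall i, phi (u m) i @[m --> \oo] --> phi r i.

End Income.

(* Main.v *)
(* Consistency and independence of future incomes force
   [phi r j = share j * (r j + reserve j)], where [reserve j] is the income
   left over from the periods before [j] and [share j] is the part kept from a
   unit income at [j]. Hence [r j + reserve j] satisfies the recurrence of the
   geometric rule, and the difference with the geometric sum shrinks in absolute
   value from each period to the next; as it tends to 0 at -oo, it vanishes.
   So every rule satisfying the axioms is geometric, and continuity only
   decides whether shares equal to 1 occur arbitrarily early: if they do, each
   coordinate depends on finitely many incomes; if they do not, rescaled incomes
   received ever earlier keep a fixed effect while tending pointwise to 0. *)

Require Import Defs.
From mathcomp Require Import all_boot all_order all_algebra.
From mathcomp Require Import all_classical all_reals all_analysis.
From mathcomp Require Import zify lra.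

Import Order.TTheory GRing.Theory Num.Theory.
Local Open Scope ring_scope.
Import numFieldNormedType.Exports.

(** * Sums over left half-lines of integers as limits of finite sums *)

Section StreamSums.
Set Implicit Arguments.
Unset Strict Implicit.
Local Open Scope classical_set_scope.
Context {R : realType}.
Implicit Types (f g r : int -> R) (D E : set int) (i j : int) (n : nat).

Lemma summable_subset D E f :
  D `<=` E -> summable E (EFin \o f) -> summable D (EFin \o f).
Proof.
move=> DE; apply: le_lt_trans; apply: ereal_sup_le => _ [F [finF FD] <-].
by exists F => //; split=> // x /FD /DE.
Qed.

Lemma summable_le D f g :
  (forall i, `|f i| <= `|g i|) -> summable D (EFin \o g) ->
  summable D (EFin \o f).
Proof.
by move=> fg; apply: le_lt_trans; apply: le_esum => i _ /=; rewrite lee_fin.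
Qed.

Lemma L1plus_summable D r : L1plus r -> summable D (EFin \o r).
Proof. by move=> [r1 _]; apply: summable_subset r1. Qed.

Lemma set_bij_left i :
  set_bij [set: nat] [set j | j <= i] (fun n => i - n%:Z).
Proof.
split=> [n _ /=||j /= ji]; first by rewrite gerBl.
  by move=> m n _ _ /= /(congr1 (fun x => i - x)); rewrite !subKr => -[].
by exists `|i - j|%N => //=; rewrite gez0_abs ?subr_ge0// subKr.
Qed.

(** Counting down from [i] enumerates the half-line by the naturals, which turns the unordered sum
    into an ordinary series. *)
Lemma esum_left_cvg i g :
  (forall j, 0 <= g j) -> summable [set j | j <= i] (EFin \o g) ->
  \sum_(0 <= k < n) g (i - k%:Z) @[n --> \oo]
    --> fine (\esum_(j in [set j | j <= i]) (g j)%:E).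
Proof.
move=> g0 gs; set h := fun k : nat => (g (i - k%:Z))%:E.
have h0 k : (0 <= h k)%E by rewrite lee_fin.
have hs : summable xpredT h.
  move: gs; rewrite /summable (reindex_esum _ _ _ _ (set_bij_left i)).
  by rewrite (_ : [set: nat] = [set` xpredT])// set_true.
rewrite (reindex_esum _ _ _ _ (set_bij_left i)) -nneseries_esumT//.
rewrite (summable_nneseries_lim _ hs)//=.
exact: (summable_cvg _ hs).
Qed.

Lemma zsum_funrposneg D f : summable D (EFin \o f) ->
  zsum D f = fine (\esum_(j in D) (f^\+ j)%:E)
    - fine (\esum_(j in D) (f^\- j)%:E).
Proof.
move=> fs; rewrite /zsum fineB ?funerpos ?funerneg//.
- move: (summable_funepos fs); rewrite summableE funerpos.
  by under eq_esum do rewrite gee0_abs ?lee_fin ?funrpos_ge0//.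
- move: (summable_funeneg fs); rewrite summableE funerneg.
  by under eq_esum do rewrite gee0_abs ?lee_fin ?funrneg_ge0//.
Qed.

(** Positive and negative parts converge separately. Through this limit, linearity, monotonicity and
    tail estimates for [zsum] follow from those of finite sums. *)
Lemma zsum_left_cvg i f : summable [set j | j <= i] (EFin \o f) ->
  \sum_(0 <= k < n) f (i - k%:Z) @[n --> \oo] --> zsum [set j | j <= i] f.
Proof.
move=> fs; rewrite zsum_funrposneg//.
under eq_fun => n.
  rewrite (_ : \sum_(0 <= k < n) f (i - k%:Z) =
     \sum_(0 <= k < n) f^\+ (i - k%:Z) - \sum_(0 <= k < n) f^\- (i - k%:Z)).
    over.
  rewrite -sumrB; apply: eq_bigr => k _.
  by have /(congr1 (fun h => h (i - k%:Z))) /= := funrposBneg f.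
apply: cvgB; apply: esum_left_cvg => //.
- by rewrite -funerpos; exact: summable_funepos.
- by rewrite -funerneg; exact: summable_funeneg.
Qed.

Lemma eq_zsum D f g : (forall i, D i -> f i = g i) -> zsum D f = zsum D g.
Proof.
move=> fg; rewrite /zsum; congr (fine (_ - _)); apply: eq_esum => i Di;
  by rewrite ?funeposE ?funenegE /= fg.
Qed.

Lemma ge0_zsumE D f : (forall i, 0 <= f i) ->
  zsum D f = fine (\esum_(i in D) (f i)%:E).
Proof.
move=> f0; rewrite /zsum [X in (_ - X)%E]esum1 ?sube0; last first.
  by move=> i _; rewrite (@ge0_funenegE _ _ setT) ?in_setT// => j _; rewrite lee_fin.
congr fine; apply: eq_esum => i _.
by rewrite (@ge0_funeposE _ _ setT) ?in_setT// => j _; rewrite lee_fin.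
Qed.

Lemma zsum_ge0 D f : (forall i, 0 <= f i) -> 0 <= zsum D f.
Proof.
by move=> f0; rewrite ge0_zsumE// fine_ge0// esum_ge0// => i _; rewrite lee_fin.
Qed.

Lemma zsum_eq0 D f : (forall i, D i -> f i = 0) -> zsum D f = 0.
Proof.
by move=> /(eq_zsum (g := fun=> 0)) ->; rewrite ge0_zsumE// esum1.
Qed.

Lemma summable_fin_num D f : (forall i, 0 <= f i) -> summable D (EFin \o f) ->
  (\esum_(i in D) (f i)%:E)%E \is a fin_num.
Proof.
by move=> f0; rewrite summableE; under eq_esum do rewrite gee0_abs ?lee_fin//.
Qed.

(** For a nonnegative family, the unordered sum is the supremum of its finite subsums. *)
Lemma zsum_le_finite D f (c : R) : (forall i, 0 <= f i) ->
    summable D (EFin \o f) ->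
    (forall F, finite_set F -> F `<=` D -> zsum F f <= c) ->
  zsum D f <= c.
Proof.
move=> f0 fs Fc; rewrite ge0_zsumE// -lee_fin fineK ?summable_fin_num//.
apply: ge_ereal_sup => _ [F [finF FD] <-]; rewrite -esum_fset//; last first.
  by move=> i _; rewrite lee_fin.
rewrite -[leLHS]fineK ?lee_fin -?ge0_zsumE//; first exact: Fc.
by apply: summable_fin_num => //; exact: summable_subset fs.
Qed.

Lemma zsum_subset D E f : (forall i, 0 <= f i) -> summable E (EFin \o f) ->
  D `<=` E -> zsum D f <= zsum E f.
Proof.
move=> f0 fs DE; rewrite !ge0_zsumE// fine_le ?summable_fin_num//.
  exact: summable_subset fs.
by apply: ereal_sup_le => _ [F [finF FD] <-]; exists F => //; split=> // x /FD /DE.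
Qed.

(** A finite set of integers is bounded above, so each finite subsum is dominated by the sum over
    some left half-line. *)
Lemma zsumT_le f (c : R) : (forall i, 0 <= f i) -> L1 f ->
  (forall i, zsum [set j | j <= i] f <= c) -> zsum [set: int] f <= c.
Proof.
move=> f0 fs fc; apply: zsum_le_finite => // F finF _.
have [i Fi] : exists i, F `<=` [set j | j <= i].
  have /finite_seqP[s ->] := finF.
  elim: s => [|x s [i si]]; first by exists 0.
  exists (Num.max x i) => y /=; rewrite in_cons le_max.
  by case/predU1P => [->|/si /= ->]; rewrite ?lexx ?orbT.
apply: le_trans (fc i); apply: zsum_subset => //.
exact: summable_subset fs.
Qed.

Lemma zsum_left_eq i f (l : R) : summable [set j | j <= i] (EFin \o f) ->
  \sum_(0 <= k < n) f (i - k%:Z) @[n --> \oo] --> l ->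
  zsum [set j | j <= i] f = l.
Proof. by move=> /zsum_left_cvg fi fl; exact: (cvg_unique _ fi fl). Qed.

Lemma zsum_leftS i f : summable [set j | j <= i] (EFin \o f) ->
  zsum [set j | j <= i] f = f i + zsum [set j | j <= i - 1] f.
Proof.
(* Shifting the index of the sequence by one makes every partial sum contain the term at [i]. *)
move=> fs; apply: zsum_left_eq => //; rewrite -cvg_shiftS /=.
have shift n : \sum_(0 <= k < n.+1) f (i - k%:Z) =
    f i + \sum_(0 <= k < n) f (i - 1 - k%:Z).
  rewrite big_nat_recl//= subr0; congr (_ + _); apply: eq_bigr => k _.
  by congr f; lia.
under eq_fun do rewrite shift.
apply: cvgD; first exact: cvg_cst.
apply: zsum_left_cvg; apply: summable_subset fs => j /=; lia.
Qed.

(** The tail is the whole sum minus a partial sum that converges to it. *)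
Lemma zsum_left_cvg0 i f : summable [set j | j <= i] (EFin \o f) ->
  zsum [set j | j <= i - n%:Z] f @[n --> \oo] --> (0 : R).
Proof.
move=> fs.
under eq_fun => n.
  rewrite (_ : zsum _ _ =
    zsum [set j | j <= i] f - \sum_(0 <= k < n) f (i - k%:Z)); last first.
    elim: n => [|n IH]; first by rewrite big_nil !subr0.
    rewrite big_nat_recr//= opprD addrA -IH (@zsum_leftS (i - n%:Z)); last first.
      by apply: summable_subset fs => j /=; lia.
    rewrite addrAC subrr add0r.
    by have -> : i - n%:Z - 1 = i - n.+1%:Z by lia.
  over.
have : zsum [set j | j <= i] f - \sum_(0 <= k < n) f (i - k%:Z) @[n --> \oo]
    --> zsum [set j | j <= i] f - zsum [set j | j <= i] f.
  by apply: cvgB; [exact: cvg_cst|exact: zsum_left_cvg].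
by rewrite subrr.
Qed.

Lemma summable_left_cvg0 i f : summable [set j | j <= i] (EFin \o f) ->
  f (i - n%:Z) @[n --> \oo] --> (0 : R).
Proof.
move=> /zsum_left_cvg fi; apply: cvg_series_cvg_0; apply/cvg_ex.
by exists (zsum [set j | j <= i] f).
Qed.

Lemma zsum_leftB i f g : summable [set j | j <= i] (EFin \o f) ->
  summable [set j | j <= i] (EFin \o g) ->
  zsum [set j | j <= i] (fun j => f j - g j) =
  zsum [set j | j <= i] f - zsum [set j | j <= i] g.
Proof.
move=> fs gs; apply: zsum_left_eq; first exact: summableB fs gs.
under eq_fun do rewrite sumrB.
by apply: cvgB; exact: zsum_left_cvg.
Qed.

Lemma zsum_leftZ i f (a : R) : summable [set j | j <= i] (EFin \o f) ->
  summable [set j | j <= i] (EFin \o (fun j => a * f j)) ->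
  zsum [set j | j <= i] (fun j => a * f j) = a * zsum [set j | j <= i] f.
Proof.
move=> fs afs; apply: zsum_left_eq => //.
under eq_fun do rewrite -mulr_sumr.
by apply: cvgM; [exact: cvg_cst|exact: zsum_left_cvg].
Qed.

Lemma zsum_left_le i f g : summable [set j | j <= i] (EFin \o f) ->
  summable [set j | j <= i] (EFin \o g) -> (forall j, j <= i -> f j <= g j) ->
  zsum [set j | j <= i] f <= zsum [set j | j <= i] g.
Proof.
move=> fs gs fg; apply: (ler_cvg_to (zsum_left_cvg fs) (zsum_left_cvg gs)).
by apply: nearW => n; apply: ler_sum => k _; rewrite fg// gerBl.
Qed.

(* Going down from [i], [|D|] increases yet tends to [0]. *)
Lemma decay_eq0 (D : int -> R) i :
  (forall j, `|D j| <= `|D (j - 1)|) ->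
  D (i - n%:Z) @[n --> \oo] --> (0 : R) -> D i = 0.
Proof.
move=> Dle D0; apply/normr0_eq0/eqP; rewrite eq_le normr_ge0 andbT.
rewrite -(normr0 R); apply: (ler_cvg_to (cvg_cst `|D i|) (cvg_norm D0)).
apply: nearW => n /=; elim: n => [|n IH]; first by rewrite subr0.
by apply: le_trans IH _; rewrite -addn1 PoszD opprD addrA.
Qed.
End StreamSums.

(** * The discounted sum inside the geometric rule and its recurrence *)

Section Geometric.
Set Implicit Arguments.
Unset Strict Implicit.
Local Open Scope classical_set_scope.
Context {R : realType}.
Variable lambda : int -> R.
Hypothesis lambda01 : forall i, 0 <= lambda i <= 1.
Implicit Types (r : int -> R) (D : set int) (i j : int) (n : nat).

(** The fraction of an income at [j] that is still unallocated on arrival at [i]. By unfolding,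
    [geometric_rule lambda r i] is [lambda i * carried lambda r i]. *)
Definition discount j i : R :=
  \big[*%R/1]_(k \in [set k | j <= k < i]) (1 - lambda k).

Definition carried r i : R :=
  zsum [set j | j <= i] (fun j => discount j i * r j).

(** Finiteness allows a factor to be split off the product in [discount]; over an infinite support
    that product would default to 1. *)
Lemma finite_int_itv i j : finite_set [set k : int | j <= k < i].
Proof.
apply: (@sub_finite_set _ _ ((fun n => j + n%:Z) @` `I_(`|i - j|%N))).
  by move=> k /= /andP[jk ki]; exists `|k - j|%N => /=; lia.
exact/finite_image/finite_II.
Qed.

Lemma discount_ge i j : i <= j -> discount j i = 1.
Proof. by move=> ij; apply: fsbig1 => k /=; lia. Qed.

Lemma discount_pred j i : j < i ->
  discount j i = (1 - lambda (i - 1)) * discount j (i - 1).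
Proof.
move=> ji; rewrite /discount (fsbigD1 (i - 1))//; last by rewrite /=; lia.
  by congr (_ * _); apply: eq_fsbigl; apply/seteqP; split=> k /=; lia.
exact: finite_int_itv.
Qed.

Lemma discount01 j i : 0 <= discount j i <= 1.
Proof.
rewrite /discount; elim/big_ind: _ => [|x y /andP[x0 x1] /andP[y0 y1]|k _].
- by rewrite ler01 lexx.
- by rewrite mulr_ge0// mulr_ile1.
- by have := lambda01 k; lra.
Qed.

Lemma discount_ge0 j i : 0 <= discount j i.
Proof. by case/andP: (discount01 j i). Qed.

Lemma discount_neq0 j i :
  (forall k, j <= k < i -> lambda k != 1) -> discount j i != 0.
Proof.
(* The product is either empty or runs over a finite sequence [X] inside the interval. *)
move=> l1; rewrite /discount; case: finite_supportP => [_|X XP _ _].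
  by rewrite big_nil oner_eq0.
rewrite prodf_seq_neq0; apply/allP => k /XP /l1 /=.
by rewrite subr_eq0 eq_sym.
Qed.

Lemma summable_discount D r i : L1plus r ->
  summable D (EFin \o (fun j => discount j i * r j)).
Proof.
move=> rL; apply: (@summable_le _ _ _ r); last exact: L1plus_summable.
move=> j; have [_ r0] := rL; have /andP[d0 d1] := discount01 j i.
by rewrite normrM !ger0_norm// ler_piMl.
Qed.

Lemma eq_carried r r' i : (forall j, j <= i -> r j = r' j) ->
  carried r i = carried r' i.
Proof. by move=> rr'; apply: eq_zsum => j /= /rr' ->. Qed.

(** The term at [i] has an empty product, and every earlier term contains the factor
    [1 - lambda (i - 1)]. *)
Lemma carried_pred r i : L1plus r ->
  carried r i = r i + (1 - lambda (i - 1)) * carried r (i - 1).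
Proof.
move=> rL; rewrite /carried zsum_leftS; last exact: summable_discount.
rewrite discount_ge// mul1r -zsum_leftZ; last 2 first.
- exact: summable_discount.
- apply: (@summable_le _ _ _ (fun j => discount j (i - 1) * r j)).
    move=> j; rewrite normrM ler_piMl// ger0_norm; have := lambda01 (i - 1); lra.
  exact: summable_discount.
congr (_ + _); apply: eq_zsum => j /= ji.
by rewrite discount_pred ?mulrA//; lia.
Qed.

Lemma carried_ge0 r i : L1plus r -> 0 <= carried r i.
Proof.
by move=> [_ r0]; apply: zsum_ge0 => j; rewrite mulr_ge0 ?discount_ge0.
Qed.

Lemma carried_le r i : L1plus r -> carried r i <= zsum [set j | j <= i] r.
Proof.
move=> rL; have [_ r0] := rL; apply: zsum_left_le.
- exact: summable_discount.
- exact: L1plus_summable.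
- by move=> j _; have /andP[_ d1] := discount01 j i; rewrite ler_piMl.
Qed.

(** Discounts are at most 1, so the carried amount is squeezed between 0 and a tail of the summable
    stream. *)
Lemma carried_cvg0 r i : L1plus r ->
  carried r (i - n%:Z) @[n --> \oo] --> (0 : R).
Proof.
move=> rL; apply: (squeeze_cvgr _ (cvg_cst 0)).
  by apply: nearW => n; rewrite carried_ge0//=; exact: carried_le.
by apply: zsum_left_cvg0; exact: L1plus_summable.
Qed.

Lemma carried_eq0 r i : (forall j, j <= i -> r j = 0) -> carried r i = 0.
Proof.
by move=> r0; apply: zsum_eq0 => j /r0 ->; rewrite mulr0.
Qed.
End Geometric.

(** * The reserve of a rule compared with the geometric sum *)

Section Reserve.
Set Implicit Arguments.
Unset Strict Implicit.
Local Open Scope classical_set_scope.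
Context {R : realType}.
Variables (lambda : int -> R) (phi : rule R) (r : int -> R).
Hypothesis lambda01 : forall i, 0 <= lambda i <= 1.
Hypothesis rL : L1plus r.
Hypothesis phirL : L1plus (phi r).
Implicit Types (i j : int) (n : nat).

(** This is the amount that [reduced_stream] adds to the income at [j]. *)
Definition reserve j : R := zsum [set k | k < j] (fun k => r k - phi r k).

Lemma set_lt_pred j : [set k : int | k < j] = [set k | k <= j - 1].
Proof. by apply/seteqP; split=> k /=; lia. Qed.

Lemma summable_reserve (D : set int) :
  summable D (EFin \o (fun k => r k - phi r k)).
Proof. exact: summableB (L1plus_summable D rL) (L1plus_summable D phirL). Qed.

Lemma reserve_pred j :
  reserve j = reserve (j - 1) + (r (j - 1) - phi r (j - 1)).
Proof.
rewrite /reserve !set_lt_pred zsum_leftS 1?addrC//.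
exact: summable_reserve.
Qed.

Lemma reserve_cvg0 i : reserve (i - n%:Z) @[n --> \oo] --> (0 : R).
Proof.
rewrite (_ : (fun n => _) =
    fun n => zsum [set j | j <= i - 1 - n%:Z] (fun k => r k - phi r k)).
  by apply: zsum_left_cvg0; exact: summable_reserve.
by apply/funext => n; rewrite /reserve set_lt_pred addrAC.
Qed.

Lemma L1plus_cvg0 i : r (i - n%:Z) @[n --> \oo] --> (0 : R).
Proof. by apply: summable_left_cvg0; exact: L1plus_summable. Qed.

Lemma reserve_split j : reserve j =
  zsum [set k | k < j] r - zsum [set k | k < j] (phi r).
Proof. by rewrite /reserve set_lt_pred zsum_leftB//; exact: L1plus_summable. Qed.

(** The difference of the two sides takes the same value at [j] and at [j - 1], and it tends to 0 at
    -oo. *)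
Lemma reserve_geometric :
  (forall i, phi r i = lambda i * carried lambda r i) ->
  forall j, reserve j = carried lambda r j - r j.
Proof.
move=> phiE j; apply/eqP; rewrite -subr_eq0; apply/eqP.
apply: (@decay_eq0 _ (fun j => reserve j - (carried lambda r j - r j))).
  move=> {}j; rewrite (reserve_pred j) phiE (carried_pred lambda01 j)//.
  rewrite le_eqVlt; apply/orP; left; apply/eqP; congr `|_|; lra.
rewrite (_ : 0 = 0 - (0 - 0)); last by rewrite !subr0.
apply: cvgB; first exact: reserve_cvg0.
by apply: cvgB; [exact: carried_cvg0|exact: L1plus_cvg0].
Qed.

(** Here the difference at [j] is [1 - lambda (j - 1)] times the difference at [j - 1]. The
    recurrence alone leaves a boundary value free; the limit 0 at -oo fixes it. *)
Lemma geometric_reserve :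
  (forall i, phi r i = lambda i * (r i + reserve i)) ->
  forall j, r j + reserve j = carried lambda r j.
Proof.
move=> phiE j; apply/eqP; rewrite -subr_eq0; apply/eqP.
apply: (@decay_eq0 _ (fun j => r j + reserve j - carried lambda r j)).
  move=> {}j; rewrite [in leLHS]reserve_pred phiE (carried_pred lambda01 j)//.
  set x := r (j - 1) + reserve (j - 1); set c := carried _ _ (j - 1).
  rewrite (_ : _ - _ = (1 - lambda (j - 1)) * (x - c)); last first.
    by rewrite mulrBr mulrBl mul1r /x; lra.
  rewrite normrM ler_piMl// ger0_norm; have := lambda01 (j - 1); lra.
rewrite (_ : 0 = 0 + 0 - 0); last by rewrite subr0 addr0.
apply: cvgB; last exact: carried_cvg0.
by apply: cvgD; [exact: L1plus_cvg0|exact: reserve_cvg0].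
Qed.
End Reserve.

(** * Closure properties of summable streams, one-income streams and truncation *)

Section Streams.
Set Implicit Arguments.
Unset Strict Implicit.
Local Open Scope classical_set_scope.
Context {R : realType}.
Implicit Types (f r : int -> R) (D : set int) (a : R) (i j : int) (n : nat).

(** An Archimedean bound on [|a|] dominates the family by a natural multiple of [f], which is
    summable by repeated addition. *)
Lemma summableZ D f a : summable D (EFin \o f) ->
  summable D (EFin \o (fun i => a * f i)).
Proof.
move=> fs; apply: (@summable_le _ _ _ (fun i => (Num.bound `|a|)%:R * f i)).
  move=> i; rewrite !normrM ler_wpM2r// normr_nat ltW//.
  exact: archi_boundP.
elim: (Num.bound _) => [|n IH].
  by apply: summable_le fs => i; rewrite mul0r normr0.
rewrite (_ : EFin \o _ = (EFin \o (fun i => (n%:R * f i)%R)) \+ (EFin \o f))%E.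
  exact: summableD.
by apply/funext => i /=; rewrite -EFinD -natr1 mulrDl mul1r.
Qed.

Lemma L1plusZ r a : L1plus r -> 0 <= a -> L1plus (fun i => a * r i).
Proof.
move=> [r1 r0] a0; split; first exact: summableZ.
by move=> i; rewrite mulr_ge0.
Qed.

Lemma L1plus_le f r : L1plus r -> (forall i, 0 <= f i <= r i) -> L1plus f.
Proof.
move=> [r1 r0] fr; split=> [|i]; last by case/andP: (fr i).
apply: summable_le r1 => i; have /andP[f0 fri] := fr i.
by rewrite !ger0_norm.
Qed.

Lemma L1plusD f r : L1plus f -> L1plus r -> L1plus (fun i => f i + r i).
Proof.
move=> [f1 f0] [r1 r0]; split; first exact: summableD f1 r1.
by move=> i; rewrite addr_ge0.
Qed.

Definition single j a : int -> R := fun i => if i == j then a else 0.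

Lemma L1plus_single j a : 0 <= a -> L1plus (single j a).
Proof.
move=> a0; split=> [|i]; last by rewrite /single; case: eqP.
rewrite /L1 /= /summable (_ : esum _ _ = \esum_(i in [set j]) (a%:E))%E.
  by rewrite esum_set1 ?lee_fin// ltry.
rewrite [RHS]esum_mkcond; apply: eq_esum => i _ /=.
rewrite /single; case: eqP => [->|ij]; first by rewrite mem_set// ger0_norm.
by rewrite memNset// normr0.
Qed.

Definition truncate i r : int -> R := fun k => if k <= i then r k else 0.

Lemma L1plus_truncate i r : L1plus r -> L1plus (truncate i r).
Proof.
move=> rL; apply: (L1plus_le rL) => k; have [_ r0] := rL.
by rewrite /truncate; case: ifP; rewrite ?lexx ?r0.
Qed.

Lemma zsumT_truncate i r : L1plus r ->
  zsum [set: int] (truncate i r) = zsum [set k | k <= i] r.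
Proof.
move=> rL; have [_ t0] := L1plus_truncate i rL; have [_ r0] := rL.
rewrite !ge0_zsumE//; congr fine; rewrite [RHS]esum_mkcond.
apply: eq_esum => k _; rewrite /truncate; case: (boolP (k <= i)) => ki.
  by rewrite mem_set.
by rewrite memNset//; exact/negP.
Qed.
End Streams.

(** * Geometric rules satisfy the axioms *)

Section GeometricAxioms.
Set Implicit Arguments.
Unset Strict Implicit.
Local Open Scope classical_set_scope.
Context {R : realType}.
Variables (lambda : int -> R) (phi : rule R).
Hypothesis phi_alloc : allocation_rule phi.
Hypothesis lambda01 : forall i, 0 <= lambda i <= 1.
Hypothesis phi_geom : is_geometric lambda phi.

Lemma geometricE r i : L1plus r -> phi r i = lambda i * carried lambda r i.
Proof. by move=> rL; exact: phi_geom rL i. Qed.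

Lemma geometric_feasibility : feasibility phi.
Proof.
move=> r rL; have prL := phi_alloc rL.
apply: zsumT_le; [exact: prL.2|exact: prL.1|].
move=> i; apply: (@le_trans _ _ (zsum [set j | j <= i] r)); last first.
  by apply: zsum_subset; [exact: rL.2|exact: rL.1|].
(* Income minus allocation up to [i] is the reserve at [i + 1], which equals
   [(1 - lambda i) * carried lambda r i] and is therefore nonnegative. *)
have := reserve_split rL prL (i + 1); rewrite set_lt_pred addrK.
rewrite (reserve_geometric lambda01 rL prL (fun i => geometricE i rL)).
rewrite (carried_pred lambda01)// addrK.
have := carried_ge0 lambda01 i rL; have := lambda01 i; nra.
Qed.

Lemma geometric_scale_invariance : scale_invariance phi.
Proof.
move=> r a rL a0 i; have arL := L1plusZ rL a0; rewrite !geometricE// mulrCA.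
congr (_ * _); rewrite /carried -zsum_leftZ; last 2 first.
- exact: summable_discount.
- exact/summableZ/summable_discount.
by apply: eq_zsum => j _; rewrite mulrCA.
Qed.

Lemma geometric_independence_future : independence_future phi.
Proof.
move=> j r r' rL r'L rr' i ij; rewrite !geometricE//; congr (_ * _).
by apply: eq_carried => k ki; apply: rr'; lia.
Qed.

(** Both streams carry the same amount at [j], and from there on they obey the same recurrence with
    the same incomes. *)
Lemma geometric_consistency : consistency phi.
Proof.
move=> r j rL; set s := reduced_stream phi r j => sL i ji.
rewrite !geometricE//; congr (_ * _).
have -> : i = j + `|i - j|%N%:Z by lia.
elim: `|i - j|%N => [|n IH].
  (* The reduced stream vanishes before [j], so at [j] it carries only its own entry
     [r j + reserve phi r j], which is what [r] carries there. *)
  rewrite addr0 (carried_pred lambda01 j sL).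
  rewrite (@carried_eq0 _ _ s) ?mulr0 ?addr0; last first.
    by move=> k kj; rewrite /s /reduced_stream !ifF//; lia.
  rewrite /s /reduced_stream ltxx eqxx -/(reserve phi r j).
  have phiE k := geometricE k rL.
  by rewrite (reserve_geometric lambda01 rL (phi_alloc rL) phiE) subrKC.
rewrite !(carried_pred lambda01 (j + n.+1%:Z))//.
have -> : j + n.+1%:Z - 1 = j + n%:Z by lia.
by rewrite IH /s /reduced_stream ifT//; lia.
Qed.

(** Nothing is carried past a period [l] with [lambda l = 1]. The amount carried to a later [i] then
    comes from finitely many steps of the recurrence, each preserving pointwise limits. *)
Lemma geometric_continuity :
  (forall i, exists j, j < i /\ lambda j = 1) -> pointwise_continuity phi.
Proof.
move=> ones r u rL uL ur i.
under eq_fun do rewrite geometricE//.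
rewrite geometricE//; apply: cvgM; first exact: cvg_cst.
have [l [li l1]] := ones i.
have -> : i = l + `|i - l|%N%:Z by lia.
have : (0 < `|i - l|)%N by lia.
(* The induction starts at [l + 1], where the carried amount is just the current income. *)
case: `|i - l|%N => // n _; elim: n => [|n IH].
  have lE s : L1plus s -> carried lambda s (l + 1) = s (l + 1).
    by move=> sL; rewrite (carried_pred lambda01)// addrK l1 subrr mul0r addr0.
  by under eq_fun do rewrite lE//; rewrite lE//; exact: ur.
under eq_fun do rewrite (carried_pred lambda01)//.
rewrite (carried_pred lambda01)//; apply: cvgD; first exact: ur.
have -> : l + n.+2%:Z - 1 = l + n.+1%:Z by lia.
by apply: cvgM; [exact: cvg_cst|exact: IH].
Qed.
End GeometricAxioms.

(** * The axioms force a geometric rule, and continuity constrains its shares *)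

Section AxiomsGeometric.
Set Implicit Arguments.
Unset Strict Implicit.
Local Open Scope classical_set_scope.
Context {R : realType}.
Variable phi : rule R.
Hypothesis phi_alloc : allocation_rule phi.
Hypothesis phi_feasible : feasibility phi.
Hypothesis phi_scale : scale_invariance phi.
Hypothesis phi_future : independence_future phi.
Hypothesis phi_consistent : consistency phi.
Hypothesis phi_continuous : pointwise_continuity phi.
Implicit Types (r : int -> R) (a : R) (i j k : int) (n : nat).

(** Independence of a future income alters one period at a time, hence finitely many; continuity
    then covers all later periods at once. *)
Lemma phi_truncate r i : L1plus r -> phi r i = phi (truncate i r) i.
Proof.
(* The streams [u n] restore the future incomes one by one; each coordinate is eventually that of
   [r]. *)
move=> rL; pose u n := truncate (i + n%:Z) r.
have uL n : L1plus (u n) by exact: L1plus_truncate.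
have ur k : u n k @[n --> \oo] --> r k.
  apply: cvg_near_cst; near=> n; rewrite /u /truncate ifT//.
  have : (`|k - i| <= n)%N by near: n; exact: nbhs_infty_ge.
  lia.
have uE n : phi (u n) i = phi (truncate i r) i.
  elim: n => [|n <-]; first by rewrite /u addr0.
  apply: (phi_future (j := i + n.+1%:Z)) => //; last lia.
  move=> k /eqP kj; rewrite /u /truncate.
  by have -> : (k <= i + n.+1%:Z) = (k <= i + n%:Z) by lia.
have : phi (u n) i @[n --> \oo] --> phi r i by exact: phi_continuous.
under eq_fun do rewrite uE.
by move=> /(cvg_unique _ (cvg_cst _)) ->.
Unshelve. all: by end_near.
Qed.

Lemma eq_phi_past r r' i : L1plus r -> L1plus r' ->
  (forall k, k <= i -> r k = r' k) -> phi r i = phi r' i.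
Proof.
move=> rL r'L rr'; rewrite phi_truncate// [RHS]phi_truncate//.
congr (phi _ i); apply/funext => k; rewrite /truncate.
by case: ifP => // /rr'.
Qed.

Lemma phi_single j a i : 0 <= a ->
  phi (single j a) i = a * phi (single j 1) i.
Proof.
move=> a0; rewrite -phi_scale//; last exact: L1plus_single.
congr (phi _ i); apply/funext => k; rewrite /single.
by case: eqP; rewrite ?mulr1 ?mulr0.
Qed.

(** Feasibility is applied to the stream cut off after [j - 1], on which [phi] agrees with [phi r]
    up to [j - 1]. *)
Lemma reserve_ge0 r j : L1plus r -> 0 <= reserve phi r j.
Proof.
move=> rL; have prL := phi_alloc rL.
have tL := L1plus_truncate (j - 1) rL; have ptL := phi_alloc tL.
rewrite reserve_split// subr_ge0 set_lt_pred -(zsumT_truncate (j - 1) rL).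
apply: (le_trans _ (phi_feasible tL)).
rewrite (eq_zsum (g := phi (truncate (j - 1) r))); last first.
  move=> k /= kj; apply: eq_phi_past => // l lk.
  by rewrite /truncate ifT//; lia.
by apply: zsum_subset; [exact: ptL.2|exact: ptL.1|].
Qed.

(** This makes the premise of [consistency] hold at every stream and period. The reduced stream is
    dominated by [r] plus a single income equal to the reserve. *)
Lemma L1plus_reduced r j : L1plus r -> L1plus (reduced_stream phi r j).
Proof.
move=> rL; have r0 := rL.2; have R0 := reserve_ge0 j rL.
apply: (L1plus_le (L1plusD rL (L1plus_single j R0))) => i.
rewrite /reduced_stream -/(reserve phi r j) /single.
have := r0 i; have := r0 j.
by case: ltgtP => [|_|<-]; lra.
Qed.

Definition share i : R := phi (single i 1) i.

(** By consistency [r] may be replaced by its reduced stream, which up to [j] is a single income at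
    [j]; scale invariance then extracts the amount. *)
Lemma phi_reserve r j : L1plus r ->
  phi r j = share j * (r j + reserve phi r j).
Proof.
move=> rL; have R0 : 0 <= r j + reserve phi r j.
  by rewrite addr_ge0 ?reserve_ge0//; exact: rL.2.
rewrite (phi_consistent rL (L1plus_reduced j rL) (lexx j)).
rewrite mulrC -phi_single//; apply: eq_phi_past.
- exact: L1plus_reduced.
- exact: L1plus_single.
- by move=> k kj; rewrite /reduced_stream /single; case: ltgtP kj => // ->.
Qed.

(** Before a unit income at [i] nothing is received or allocated, so the reserve at [i + 1] is
    [1 - share i], and reserves are nonnegative. *)
Lemma share01 i : 0 <= share i <= 1.
Proof.
have eL : L1plus (single i (1 : R)) by exact: L1plus_single.
have pL := phi_alloc eL; rewrite pL.2 /=.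
have phi0 k : k < i -> phi (single i 1) k = 0.
  move=> ki; rewrite (@eq_phi_past _ (single i 0))//.
  - by rewrite phi_single// mul0r.
  - exact: L1plus_single.
  - by move=> l lk; rewrite /single; case: eqP => //; lia.
have := reserve_ge0 (i + 1) eL; rewrite reserve_pred// addrK.
rewrite [reserve _ _ i]zsum_eq0 => [|k /= ki]; last first.
  by rewrite phi0// /single ifF ?subrr//; lia.
by rewrite add0r subr_ge0 [X in _ <= X]/single eqxx.
Qed.

Lemma share_geometric : is_geometric share phi.
Proof.
move=> r rL i; rewrite phi_reserve//.
rewrite (geometric_reserve share01 rL (phi_alloc rL))//.
by move=> k; exact: phi_reserve.
Qed.

Lemma carried_single j i a : 0 <= a -> j <= i ->
  carried share (single j a) i = discount share j i * a.
Proof.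
move=> a0 ji; have eL := L1plus_single j a0.
have -> : i = j + `|i - j|%N%:Z by lia.
elim: `|i - j|%N => [|n IH].
  rewrite addr0 discount_ge// mul1r (carried_pred share01)//.
  rewrite carried_eq0 ?mulr0 ?addr0 /single ?eqxx// => k kj.
  by case: eqP => //; lia.
rewrite (carried_pred share01)// discount_pred; last lia.
have -> : j + n.+1%:Z - 1 = j + n%:Z by lia.
rewrite IH mulrA {1}/single; case: eqP => [|_]; first lia.
by rewrite add0r.
Qed.

(* Unit incomes received earlier and earlier, rescaled so that [i] always
   carries 1, tend to the zero stream pointwise. *)
Lemma share_eq0 i : (forall j, j < i -> share j != 1) -> share i = 0.
Proof.
move=> ne1; pose d n := discount share (i - n%:Z) i.
have d0 n : d n != 0 by apply: discount_neq0 => k /andP[_ /ne1].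
have dge0 n : 0 <= (d n)^-1 by rewrite invr_ge0 discount_ge0//; exact: share01.
pose u n := single (i - n%:Z) (d n)^-1.
have uL n : L1plus (u n) by exact: L1plus_single.
have zL : L1plus (single i (0 : R)) by exact: L1plus_single.
have uz k : u n k @[n --> \oo] --> single i 0 k.
  apply: cvg_near_cst; near=> n; rewrite /u /single if_same ifF//; apply/eqP.
  have : (`|i - k| < n)%N by near: n; exact: nbhs_infty_gt.
  lia.
have : phi (u n) i @[n --> \oo] --> phi (single i 0) i.
  exact: phi_continuous.
rewrite phi_single// mul0r (_ : (fun n => _) = fun=> share i); last first.
  apply/funext => n; rewrite (share_geometric (uL n)) /geometric_rule.
  rewrite -/(carried share (u n) i); rewrite carried_single ?gerBl//.
  by rewrite (divff (d0 n)) mulr1.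
by move=> /(cvg_unique _ (cvg_cst _)) ->.

Unshelve. all: by end_near.
Qed.

(** If no share before [i0] is 1, then [share_eq0] makes the share at [i0] zero, so no share before
    [i0 + 1] is 1 either. Induction upward then makes every share zero. *)
Lemma full_transfer_or_ones :
  full_transfer phi \/ forall i, exists j, j < i /\ share j = 1.
Proof.
have [ones|] := pselect (forall i, exists j, j < i /\ share j = 1); first by right.
move=> /existsNP[i0 /forallNP ne1]; left=> r rL i.
suff share0 : share i = 0 by rewrite phi_reserve// share0 mul0r.
have ne1n n j : j < i0 + n%:Z -> share j != 1.
  elim: n j => [|n IH] j.
    by rewrite addr0 => ji; apply/eqP => /(conj ji) /ne1.
  rewrite -addn1 PoszD addrA ltzD1 le_eqVlt => /predU1P[->|/IH//].
  by rewrite share_eq0// eq_sym oner_neq0.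
apply: share_eq0 => j ji; apply: (ne1n `|i - i0|%N); lia.
Qed.
End AxiomsGeometric.

Theorem theorem3 (R : realType) (phi : rule R) (phi_alloc : allocation_rule phi) :
  (feasibility phi /\ scale_invariance phi /\ independence_future phi /\
   consistency phi /\ pointwise_continuity phi)
  <->
  (full_transfer phi \/
   exists lambda : int -> R,
     (forall i, 0 <= lambda i <= 1) /\
     is_geometric lambda phi /\
     (forall i : int, exists j : int, j < i /\ lambda j = 1)).
Proof.
split=> [[feas [scale [future [cons cont]]]]|].
  have [|ones] := full_transfer_or_ones phi_alloc feas scale future cons cont.
    by left.
  right; exists (share phi); split; first by move=> i; exact: share01.
  by split; first exact: share_geometric.
case=> [phi0|[lambda [lambda01 [geom ones]]]].
  split; last split; last split; last split.
  - move=> r rL; rewrite zsum_eq0 => [|i _]; last exact: phi0.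
    by apply: zsum_ge0; exact: rL.2.
  - by move=> r a rL a0 i; rewrite !phi0 ?mulr0//; exact: L1plusZ.
  - by move=> j r r' rL r'L _ i _; rewrite !phi0.
  - by move=> r j rL sL i _; rewrite !phi0.
  - move=> r u rL uL _ i; rewrite phi0//; under eq_fun do rewrite phi0//.
    exact: cvg_cst.
split; first exact: geometric_feasibility geom.
split; first exact: geometric_scale_invariance geom.
split; first exact: geometric_independence_future geom.
split; first exact: geometric_consistency geom.
exact: geometric_continuity geom ones.
Qed.
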